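(* Let $p\in[2,\infty)$, $q=p/(p-1)$, $B>0$, and let $k\ge1$ be an integer. Let $Q$ be the quantizer $SimQ^+$ with $k$ repetitions (defined in the context). Then, for every random vector $Y\in\mathbb{R}^d$ such that $\|Y\|_q\le B$ almost surely, $Q(Y)$ can be represented in $k\log e+k\log\left(\frac dk+1\right)+k$ bits, $\mathbb{E}[Q(Y)\mid Y]=Y$, and $$\alpha_0(Q;p)\le\sqrt{\frac{B^2d^{2/p}}{k}+B^2}.$$
   Context: $\log$ is base 2; $e_1,\dots,e_d$ is the standard basis of $\mathbb{R}^d$; $Y(i)$ is the $i$th coordinate of $Y$; $[d]=\{1,\dots,d\}$. ''Can be represented in $b$ bits'' means that the encoder output takes values in a set of cardinality at most $2^b$. $SimQ$ with parameter $B'$, for inputs with $\|Y\|_1\le B'$: the encoder draws $i^*\in\{0,1,\dots,d\}$ with $P(i^*=i\mid Y)=|Y(i)|/B'$ for $i\in[d]$ and $P(i^*=0\mid Y)=1-\|Y\|_1/B'$, sets $j^*=\mathrm{sign}(Y(i^* ))$ if $i^*\in[d]$ and $j^*=1$ otherwise, and outputs $i'=i^*\cdot j^*$. The decoder outputs $B'\,\mathrm{sign}(i')\,e_{|i'|}$ if $i'\neq0$ and $0$ if $i'=0$. Denote the resulting quantizer output by $Q_{\mathrm{SimQ}}(Y;B')$. $SimQ^+$ with $k$ repetitions outputs $$Q(Y)=\frac1k\sum_{i=1}^kQ^i_{\mathrm{SimQ}}(Y;Bd^{1/p}),$$ where $Q^1_{\mathrm{SimQ}},\dots,Q^k_{\mathrm{SimQ}}$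 are independent runs of $SimQ$ on the same input $Y$ with parameter $Bd^{1/p}$ (note $\|Y\|_1\le d^{1/p}\|Y\|_q\le Bd^{1/p}$). Its encoder sends the type of the sequence of the $k$ sampled indices $i^*$ (the frequency of each index of $\{0,\dots,d\}$ in the length-$k$ sequence) together with a binary vector of length $k$ storing the signs of the coordinates of $Y$ at the nonzero indices that appear at least once, in increasing order of index. For $p\in[2,\infty]$ and a quantizer $Q$, $\alpha_0(Q;p)=\sup\sqrt{\mathbb{E}[\|Q(Y)\|_2^2]}$, the supremum being over all random vectors $Y\in\mathbb{R}^d$ with $\|Y\|_q^2\le B^2$ almost surely. *)

(* Defs.v *)
From HB Require Import structures.
From mathcomp Require Import all_boot all_order all_algebra.
From mathcomp Require Import all_classical all_reals all_analysis.
Set Implicit Arguments.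
Unset Strict Implicit.
Unset Printing Implicit Defensive.
Import Order.TTheory GRing.Theory Num.Theory.
Import numFieldNormedType.Exports.
Local Open Scope classical_set_scope.
Local Open Scope ring_scope.

Definition log2 (R : realType) (x : R) : R := ln x / ln 2.

Definition lqnorm (R : realType) (d : nat) (q : R) (v : 'rV[R]_d) : R :=
  (\sum_(i < d) `|v 0 i| `^ q) `^ q^-1.

(* The library puts the product (Borel) sigma-algebra on d.-tuple R, not on
   row vectors, so measurability of a random vector goes through tuples. *)
Definition tuple_of_rV (R : realType) (d : nat) (v : 'rV[R]_d) : d.-tuple R :=
  [tuple v 0 i | i < d].

Definition random_vector disp (T : measurableType disp) (R : realType)
    (d : nat) (Y : T -> 'rV[R]_d) : Prop :=
  measurable_fun [set: T] (fun w => tuple_of_rV (Y w)).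

(* sigma(Y) *)
Definition sigma_rV disp (T : measurableType disp) (R : realType)
    (d : nat) (Y : T -> 'rV[R]_d) : set (set T) :=
  g_sigma_algebra_preimage (fun w => tuple_of_rV (Y w)).

(* Z is a version of E[X | Y]. *)
Definition is_cond_expectation disp (T : measurableType disp) (R : realType)
    (P : probability T R) (d : nat) (Y : T -> 'rV[R]_d) (X Z : T -> R) : Prop :=
  [/\ P.-integrable [set: T] (EFin \o X),
      P.-integrable [set: T] (EFin \o Z),
      forall C : set R, measurable C -> sigma_rV Y (Z @^-1` C) &
      forall A : set T, sigma_rV Y A ->
        (\int[P]_(w in A) (X w)%:E = \int[P]_(w in A) (Z w)%:E)%E].

(* A randomized quantizer on R^d with finitely many random outcomes ("seeds"):
   seed_law y s is P(seed = s | Y = y), output y s is the value of Q(y) when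
   the seed is s, and encode/decode describe what is communicated. The value
   of seed_law is only meaningful on the admissible inputs y. *)
Record quantizer (R : realType) (d : nat) := Quantizer {
  seed : finType;
  seed_law : 'rV[R]_d -> seed -> R;
  message : Type;
  encode : 'rV[R]_d -> seed -> message;
  decode : message -> 'rV[R]_d;
  output : 'rV[R]_d -> seed -> 'rV[R]_d }.

(* S is the randomness of a run of Q on the random input Y, i.e.
   P(S = s | Y) = seed_law Y s, so that Q(Y) is fun w => output Q (Y w) (S w). *)
Definition is_run disp (T : measurableType disp) (R : realType)
    (P : probability T R) (d : nat) (Q : quantizer R d)
    (Y : T -> 'rV[R]_d) (S : T -> seed Q) : Prop :=
  forall s : seed Q,
    measurable (S @^-1` [set s]) /\
    is_cond_expectation P Y (\1_(S @^-1` [set s])) (fun w => seed_law (Y w) s).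

Definition quantized (T : Type) (R : realType) (d : nat) (Q : quantizer R d)
    (Y : T -> 'rV[R]_d) (S : T -> seed Q) : T -> 'rV[R]_d :=
  fun w => output (Y w) (S w).

Definition representable_in_bits disp (T : measurableType disp) (R : realType)
    (P : probability T R) (d : nat) (Q : quantizer R d)
    (Y : T -> 'rV[R]_d) (S : T -> seed Q) (b : R) : Prop :=
  (exists n : nat,
     ([set encode y s | y in [set: 'rV[R]_d] & s in [set: seed Q]] #<= `I_n)%card
     /\ n%:R <= 2 `^ b) /\
  {ae P, forall w, decode (encode (Y w) (S w)) = quantized Y S w}.

Definition alpha0 (R : realType) (d : nat) (B : R) (Q : quantizer R d)
    (p : \bar R) : \bar R :=
  let q := fine (hoelder_conjugate p) in
  ereal_sup [set x : \bar R |
    exists (disp : measure_display) (T : measurableType disp)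
           (P : probability T R) (Y : T -> 'rV[R]_d) (S : T -> seed Q),
      [/\ random_vector Y,
          {ae P, forall w, lqnorm q (Y w) ^+ 2 <= B ^+ 2},
          is_run P Y S &
          x = sqrte 'E_P[fun w => (lqnorm 2 (quantized Y S w) ^+ 2)%R]%E]].

Section SimQ.
Variables (R : realType) (d : nat) (B' : R).

(* The index i in {0, ..., d} is an element of 'I_d.+1; the coordinate j : 'I_d
   of MathComp is the coordinate lift ord0 j, of value j + 1, of the 1-based
   numbering. *)
Definition simq_law (y : 'rV[R]_d) (i : 'I_d.+1) : R :=
  if unlift ord0 i is Some j then `|y 0 j| / B' else 1 - lqnorm 1 y / B'.

Definition simq_sign (y : 'rV[R]_d) (i : 'I_d.+1) : int :=
  if unlift ord0 i is Some j then sgz (y 0 j) else 1.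

Definition simq_encode (y : 'rV[R]_d) (i : 'I_d.+1) : int :=
  (i : nat)%:Z * simq_sign y i.

(* e_n, for n in {1, ..., d} *)
Definition std_basis (n : nat) : 'rV[R]_d := \row_(j < d) (j.+1 == n)%:R.

Definition simq_decode (m : int) : 'rV[R]_d :=
  if m == 0 then 0 else (B' * (sgz m)%:~R) *: std_basis `|m|%N.

Definition SimQ : quantizer R d :=
  {| seed := 'I_d.+1;
     seed_law := simq_law;
     message := int;
     encode := simq_encode;
     decode := simq_decode;
     output := fun y i => simq_decode (simq_encode y i) |}.

End SimQ.

Section SimQplus.
Variables (R : realType) (d k : nat) (p B : R).

Let B' : R := B * d%:R `^ p^-1.
Let seeds := {ffun 'I_k -> seed (SimQ d B')}.

(* Independence of the k runs (conditionally on the common input). *)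
Definition simq_plus_law (y : 'rV[R]_d) (s : seeds) : R :=
  \prod_(j < k) seed_law y (s j).

Definition simq_plus_output (y : 'rV[R]_d) (s : seeds) : 'rV[R]_d :=
  k%:R^-1 *: \sum_(j < k) output y (s j).

Definition type_of (s : seeds) : {ffun 'I_d.+1 -> nat} :=
  [ffun i => #|[set j | s j == i]%SET|].

(* The nonzero indices that occur in a sequence of type t, in increasing
   order. *)
Definition occurring (t : {ffun 'I_d.+1 -> nat}) : seq 'I_d :=
  [seq i <- enum 'I_d | (0 < t (lift ord0 i))%N].

(* Bit l is the sign (true for negative) of the l-th occurring coordinate; the
   unused trailing bits are false. *)
Definition sign_bits (y : 'rV[R]_d) (t : {ffun 'I_d.+1 -> nat}) :
    k.-tuple bool :=
  [tuple nth false [seq y 0 i < 0 | i <- occurring t] l | l < k].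

Definition simq_plus_encode (y : 'rV[R]_d) (s : seeds) :
    {ffun 'I_d.+1 -> nat} * k.-tuple bool :=
  (type_of s, sign_bits y (type_of s)).

Definition simq_plus_decode (m : {ffun 'I_d.+1 -> nat} * k.-tuple bool) :
    'rV[R]_d :=
  let: (t, b) := m in
  \row_(i < d) (B' * ((t (lift ord0 i))%:R / k%:R)
                * (-1) ^+ nth false b (index i (occurring t))).

Definition SimQplus : quantizer R d :=
  {| seed := seeds;
     seed_law := simq_plus_law;
     message := {ffun 'I_d.+1 -> nat} * k.-tuple bool;
     encode := simq_plus_encode;
     decode := simq_plus_decode;
     output := simq_plus_output |}.

End SimQplus.

(* Main.v *)
(* Given Y = y, the i-th coordinate of the output is
   (B'/k) * N_i * sign(y_i), where B' = B d^(1/p) and N_i, the number of runs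
   that sample the index i, is binomial with parameters k and |y_i| / B'.  Its
   first two moments give unbiasedness and
     E[Q(y)_i^2] = (B'/k) |y_i| (1 - |y_i| / B') + y_i^2,
   whose sum over i is at most B' ||y||_1 / k + ||y||_2^2 <= B'^2/k + B^2,
   because q <= 2.  An encoder output is a multiset of size k over d + 1
   indices with k bits, and 'C(d + k, k) <= (d + k)^k / k! <= (e (d/k + 1))^k.
   Decoding can only fail when some sampled coordinate of y vanishes (sign 0
   has no bit), an event of probability zero. *)
Require Import Defs.
From HB Require Import structures.
From mathcomp Require Import all_boot all_order all_algebra.
From mathcomp Require Import all_classical all_reals all_analysis.
From mathcomp Require Import measurable_realfun ring.
Set Implicit Arguments.
Unset Strict Implicit.
Unset Printing Implicit Defensive.
Import Order.TTheory GRing.Theory Num.Theory.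
Import numFieldNormedType.Exports.
Local Open Scope classical_set_scope.
Local Open Scope ring_scope.

(** * Exponential bounds for the number of messages *)

Lemma powR_log2 (R : realType) (x : R) : 0 < x -> 2 `^ log2 x = x.
Proof.
move=> x0; rewrite /log2 /powR pnatr_eq0 /= mulfVK ?lnK ?posrE//.
by rewrite gt_eqF// ln_gt0// ltr1n.
Qed.

(** Going from n to n + 1 multiplies the left side by (n + 1)(1 + 1/n)^n and the right side by (n +
    1)e, and 1 + 1/n <= exp(1/n). The step out of n = 0 is treated apart because of the division by
    n. *)
Lemma expnn_le_fact (R : realType) (n : nat) :
  n%:R ^+ n <= n`!%:R * expR 1 ^+ n :> R.
Proof.
elim: n => [|n IH]; first by rewrite !expr0 mulr1.
have [->|n0] := posnP n.
  by rewrite !expr1 mul1r (le_trans _ (expR_ge1Dx _))// lerDl.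
have n0' : 0 < n%:R :> R by rewrite ltr0n.
rewrite factS natrM !exprS -mulrA ler_wpM2l// mulrCA.
have -> : n.+1%:R ^+ n = (1 + n%:R^-1) ^+ n * n%:R ^+ n :> R.
  by rewrite -exprMn mulrDl mul1r mulVf ?gt_eqF// -natr1.
apply: ler_pM; rewrite ?exprn_ge0 ?addr_ge0//.
have -> : expR 1 = expR (n%:R^-1 : R) ^+ n.
  by rewrite -expRM_natl mulrC mulVf// gt_eqF.
by rewrite lerXn2r ?nnegrE ?addr_ge0 ?expR_ge0 ?expR_ge1Dx.
Qed.

Lemma ffact_le_expn (n m : nat) : (n ^_ m <= n ^ m)%N.
Proof.
elim: m n => [|m IH] [|n] //.
rewrite ffactnS expnS leq_mul//= (leq_trans (IH n))//.
by case: m {IH} => // m; rewrite leq_exp2r.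
Qed.

(** Clear the denominator k^k. Since k^k <= k! e^k, it remains to see that 'C(d + k, k) k! is the
    falling factorial of d + k, at most (d + k)^k. *)
Lemma bin_le_expR (R : realType) (d k : nat) : (0 < k)%N ->
  'C(d + k, k)%:R <= (expR 1 * (d%:R / k%:R + 1)) ^+ k :> R.
Proof.
move=> k0; have k0' : 0 < k%:R :> R by rewrite ltr0n.
have -> : d%:R / k%:R + 1 = (d + k)%:R / k%:R :> R.
  by rewrite natrD mulrDl divff// gt_eqF.
rewrite mulrA expr_div_n ler_pdivlMr ?exprn_gt0//.
apply: (@le_trans _ _ ('C(d + k, k)%:R * (k`!%:R * expR 1 ^+ k))).
  by rewrite ler_wpM2l// expnn_le_fact.
rewrite exprMn mulrA -natrM bin_ffact mulrC ler_wpM2l ?exprn_ge0 ?expR_ge0//.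
by rewrite -natrX ler_nat ffact_le_expn.
Qed.


Lemma card_finset_le (T : finType) (A : {set T}) : ([set` A] #<= `I_#|A|)%card.
Proof.
have -> : [set` A] = [set enum_val i | i in [set: 'I_#|A|]].
  apply/seteqP; split=> [x xA|_ [i _ <-]]; last exact: enum_valP.
  by exists (enum_rank_in xA x) => //; rewrite enum_rankK_in.
apply: card_le_trans (card_image_le _ _) _.
have -> : `I_#|A| = [set val i | i in [set: 'I_#|A|]].
  apply/seteqP; split=> [n nA|_ [i _ <-]]; last exact: ltn_ord.
  by exists (Ordinal nA).
have : (val @` [set: 'I_#|A|] #= [set: 'I_#|A|])%card.
  by apply: inj_card_eq => x y _ _; exact: val_inj.
by rewrite card_eq_le => /andP[].
Qed.

(** * Norm comparisons on the l_q ball, by rescaling to the unit ball *)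

Lemma lqnorm_normalize (R : realType) (d : nat) (q B : R) (y : 'rV[R]_d) :
  0 < q -> 0 < B -> lqnorm q y <= B -> \sum_i (`|y 0 i| / B) `^ q <= 1.
Proof.
move=> q0 B0 yB.
have s0 : 0 <= \sum_i `|y 0 i| `^ q by apply: sumr_ge0 => i _; exact: powR_ge0.
rewrite (eq_bigr (fun i => `|y 0 i| `^ q / B `^ q)); last first.
  move=> i _; rewrite powRM ?invr_ge0 ?(ltW B0)//; congr (_ * _).
  by rewrite -powR_inv1 ?(ltW B0)// -powRrM mulN1r powRN.
rewrite -mulr_suml ler_pdivrMr ?powR_gt0// mul1r.
have -> : \sum_i `|y 0 i| `^ q = lqnorm q y `^ q.
  by rewrite -powRrM mulVf ?gt_eqF// powRr1.
by apply: ge0_ler_powR; rewrite ?nnegrE ?powR_ge0// ltW.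
Qed.

Lemma lqnorm1E (R : realType) (d : nat) (y : 'rV[R]_d) :
  lqnorm 1 y = \sum_i `|y 0 i|.
Proof.
rewrite /lqnorm invr1 powRr1; first by apply: eq_bigr => i _; rewrite powRr1.
by apply: sumr_ge0 => i _; exact: powR_ge0.
Qed.

Lemma lqnorm2_sqr (R : realType) (d : nat) (y : 'rV[R]_d) :
  lqnorm 2 y ^+ 2 = \sum_i y 0 i ^+ 2.
Proof.
rewrite /lqnorm -powR_mulrn ?powR_ge0// -powRrM mulVf ?pnatr_eq0// powRr1.
  by apply: eq_bigr => i _; rewrite powR_mulrn// real_normK// num_real.
by apply: sumr_ge0 => i _; exact: powR_ge0.
Qed.

Lemma normr_le_lqnorm (R : realType) (d : nat) (q B : R) (y : 'rV[R]_d) :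
  0 < q -> 0 < B -> lqnorm q y <= B -> forall i, `|y 0 i| / B <= 1.
Proof.
move=> q0 B0 yB i.
have : (`|y 0 i| / B) `^ q <= 1.
  apply: le_trans (lqnorm_normalize q0 B0 yB); rewrite (bigD1 i)//= lerDl.
  by apply: sumr_ge0 => j _; exact: powR_ge0.
rewrite !leNgt; apply: contra => y1.
rewrite -[ltLHS](congr1 (@^~ q) (powR1 R)) /=; apply: gt0_ltr_powR => //.
  by rewrite nnegrE.
by rewrite nnegrE divr_ge0 ?(ltW B0).
Qed.

(** After division by B every coordinate has absolute value in [0, 1], where t^2 <= t^q because q <=
    2. *)
Lemma sum_sqr_le_lqnorm (R : realType) (d : nat) (q B : R) (y : 'rV[R]_d) :
  0 < q -> q <= 2 -> 0 < B -> lqnorm q y <= B ->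
  \sum_i y 0 i ^+ 2 <= B ^+ 2.
Proof.
move=> q0 q2 B0 yB; rewrite -[leRHS]mul1r -ler_pdivrMr ?exprn_gt0// mulr_suml.
apply: le_trans (lqnorm_normalize q0 B0 yB); apply: ler_sum => i _.
have y0 : 0 <= `|y 0 i| / B by rewrite divr_ge0 ?(ltW B0).
have -> : y 0 i ^+ 2 / B ^+ 2 = (`|y 0 i| / B) `^ 2.
  by rewrite powR_mulrn// expr_div_n real_normK// num_real.
(* A zero coordinate is treated apart, since [ger_powR] asks for a positive base. *)
move: y0; rewrite le_eqVlt => /predU1P[<-|y0].
  by rewrite !powR0 ?gt_eqF.
by apply: ger_powR => //; rewrite y0 (normr_le_lqnorm q0).
Qed.

(* Young's inequality, applied to [(|y_i| / B) * d ^ (-1 / p)]. *)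
Lemma lqnorm1_le_lqnorm (R : realType) (d : nat) (p q B : R) (y : 'rV[R]_d) :
  (0 < d)%N -> 0 < p -> 0 < q -> p^-1 + q^-1 = 1 -> 0 < B ->
  lqnorm q y <= B -> lqnorm 1 y <= B * d%:R `^ p^-1.
Proof.
move=> d0 p0 q0 pq B0 yB.
have d0' : 0 < d%:R :> R by rewrite ltr0n.
have dp0 : 0 < d%:R `^ p^-1 :> R by exact: powR_gt0.
rewrite lqnorm1E -[leRHS]mul1r -ler_pdivrMr ?mulr_gt0// mulr_suml.
have young i : `|y 0 i| / (B * d%:R `^ p^-1) <=
    (`|y 0 i| / B) `^ q / q + d%:R^-1 / p.
  have -> : d%:R^-1 = ((d%:R `^ p^-1)^-1) `^ p :> R.
    by rewrite -powRN -powRrM mulNr mulVf ?gt_eqF// powR_inv1// ltW.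
  rewrite invfM mulrA; apply: conjugate_powR => //.
  - by rewrite divr_ge0 ?(ltW B0).
  - by rewrite addrC.
apply: le_trans (ler_sum _ (fun i _ => young i)) _.
rewrite big_split/= -mulr_suml sumr_const card_ord -[X in _ + X]mulr_natl.
rewrite mulrA divff ?gt_eqF// mul1r -pq addrC lerD2l ler_pdivrMr// mulVf ?gt_eqF//.
exact: lqnorm_normalize.
Qed.

(** * Moments of the occurrence counts of independent draws *)

Section MultinomialMoments.
Variables (R : realType) (I J : finType) (law : I -> R).
Hypothesis law1 : \sum_x law x = 1.

(** Independence as distributivity: a product over draws of sums over values expands into a sum over
    sequences. A factor in A keeps only the value x, and a factor outside A sums to 1. Sets A of
    size one and two yield the two moments below. *)
Lemma sum_prod_all_eq (A : {set J}) (x : I) :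
  \sum_(s : {ffun J -> I}) (\prod_j law (s j)) * [forall j in A, s j == x]%:R
  = law x ^+ #|A|.
Proof.
pose F j y := law y * (if j \in A then (y == x)%:R else 1).
have -> : law x ^+ #|A| = \prod_j \sum_y F j y.
  rewrite -prodr_const [LHS]big_mkcond; apply: eq_bigr => j _; rewrite /F.
  case: ifP => _; last by under eq_bigr do rewrite mulr1; rewrite law1.
  rewrite (bigD1 x)//= eqxx mulr1 big1 ?addr0// => y /negPf ->.
  by rewrite mulr0.
rewrite bigA_distr_bigA; apply: eq_bigr => s _; rewrite big_split/=; congr (_ * _).
rewrite -big_mkcond/=; case: (boolP [forall j in A, s j == x]).
  by move=> /forall_inP sA; rewrite big1// => j /sA ->.
rewrite negb_forall_in => /exists_inP[j jA sj].
by rewrite (bigD1 j)//= (negPf sj) mul0r.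
Qed.

Definition occurrences (s : {ffun J -> I}) (x : I) : nat :=
  #|[set j | s j == x]%SET|.

Lemma occurrencesE (s : {ffun J -> I}) (x : I) :
  (occurrences s x)%:R = \sum_j (s j == x)%:R :> R.
Proof.
rewrite /occurrences -sum1_card natr_sum [LHS]big_mkcond; apply: eq_bigr => j _.
by rewrite inE; case: eqP.
Qed.

Lemma sum_prod_occurrences (x : I) :
  \sum_(s : {ffun J -> I}) (\prod_j law (s j)) * (occurrences s x)%:R
  = #|J|%:R * law x.
Proof.
under eq_bigr do rewrite occurrencesE mulr_sumr.
rewrite exchange_big/= mulr_natl -sumr_const; apply: eq_bigr => j _.
rewrite -[law x]expr1 -(cards1 j) -sum_prod_all_eq; apply: eq_bigr => s _.
congr (_ * _%:R); apply/esym; congr nat_of_bool; apply/forall_inP/idP => [|sj i].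
  by apply; rewrite inE.
by rewrite inE => /eqP ->.
Qed.

Lemma sum_prod_occurrences_sqr (x : I) :
  \sum_(s : {ffun J -> I}) (\prod_j law (s j)) * (occurrences s x)%:R ^+ 2
  = #|J|%:R * law x * (1 - law x) + (#|J|%:R * law x) ^+ 2.
Proof.
(* The squared count is a sum over pairs of draws. Distinct draws both hit x with probability
   [law x ^+ 2]; on the diagonal the probability is [law x], the square plus the variance of one
   indicator. *)
have pair j l : \sum_(s : {ffun J -> I})
    (\prod_j law (s j)) * ((s j == x)%:R * (s l == x)%:R)
    = law x ^+ 2 + (l == j)%:R * (law x * (1 - law x)).
  transitivity (law x ^+ #|[set j; l]%SET|).
    rewrite -sum_prod_all_eq; apply: eq_bigr => s _.
    rewrite -natrM mulnb; congr (_ * _%:R); congr nat_of_bool.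
    apply/andP/forall_inP => [[sj sl] i|sA]; last by rewrite !sA ?inE ?eqxx ?orbT.
    by rewrite !inE => /orP[] /eqP ->.
  rewrite cards2 eq_sym; case: eqP => _ /=; last by rewrite mul0r addr0.
  by rewrite expr1 mul1r mulrBr mulr1 addrC -expr2 subrK.
under eq_bigr do rewrite occurrencesE expr2 mulr_suml mulr_sumr.
rewrite exchange_big/=.
transitivity (\sum_(j : J) (#|J|%:R * law x ^+ 2 + law x * (1 - law x))).
  apply: eq_bigr => j _; under eq_bigr do rewrite !mulr_sumr.
  rewrite exchange_big/=; under eq_bigr do rewrite pair.
  rewrite big_split/= sumr_const mulr_natl; congr (_ + _).
  rewrite (bigD1 j)//= eqxx mul1r big1 ?addr0// => l /negPf ->.
  by rewrite mul0r.
by rewrite sumr_const -[LHS]mulr_natl mulrDr addrC mulrA exprMn expr2 !mulrA.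
Qed.
End MultinomialMoments.

(** * SimQ and SimQ+ at a fixed input: output, code and moments *)

Lemma simq_outputE (R : realType) (d : nat) (B' : R) (y : 'rV[R]_d)
    (i : 'I_d.+1) (j : 'I_d) :
  output (q := SimQ d B') y i 0 j = B' * Num.sg (y 0 j) * (i == lift ord0 j)%:R.
Proof.
rewrite /= /simq_encode /simq_sign; case: unliftP => [l|] ->; last first.
  by rewrite mul0r /simq_decode eqxx mxE -val_eqE mulr0.
rewrite (inj_eq lift_inj) lift0 /simq_decode mulf_eq0 sgz_eq0 orFb.
(* If the sampled coordinate is 0, its sign is 0, so the message is 0 and decodes to the zero
   vector; the right side vanishes through [Num.sg]. *)
have [yl0|yl0] := eqVneq (y 0 l) 0.
  rewrite !mxE; have [lj|_] := eqVneq l j; last by rewrite mulr0.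
  by rewrite -lj yl0 sgr0 mulr0 mul0r.
have syl : `|sgz (y 0 l)%R|%N = 1%N by rewrite sgz_def yl0; case: ltP.
(* The message has absolute value [l.+1], which the one-based [std_basis] sends to the coordinate
   [l]. *)
rewrite abszM syl muln1 sgzM sgz_id gtr0_sgz// mul1r -sgrEz !mxE eqSS.
have [->|lj] := eqVneq l j; first by rewrite !eqxx.
by rewrite eq_sym val_eqE (negPf lj) !mulr0.
Qed.

Section SimQplus.
Variables (R : realType) (d k : nat) (p B : R).

Local Notation B' := (B * d%:R `^ p^-1).
Local Notation Q := (SimQplus d k p B).
Implicit Types (y : 'rV[R]_d) (s : {ffun 'I_k -> 'I_d.+1}).

(** The output coordinate without the sign of y_i. It depends on the seed alone, so its conditional
    mean given Y is an average over [seed_law]; the sign is a function of Y and is restored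
    separately. *)
Definition simq_plus_weight (i : 'I_d) (s : seed Q) : R :=
  B' / k%:R * (occurrences (s : {ffun 'I_k -> 'I_d.+1}) (lift ord0 i))%:R.

Lemma simq_plus_outputE y (s : seed Q) (i : 'I_d) :
  output y s 0 i = simq_plus_weight i s * Num.sg (y 0 i).
Proof.
rewrite /simq_plus_weight occurrencesE.
rewrite -[output _ _]/(simq_plus_output y s) !mxE summxE.
under eq_bigr do rewrite simq_outputE.
by rewrite -mulr_sumr; set c := B * _; rewrite mulrA [RHS]mulrAC mulrA [_^-1 * _]mulrC.
Qed.

Lemma sum_simq_law y : \sum_x simq_law B' y x = 1.
Proof.
rewrite big_ord_recl /simq_law unlift_none lqnorm1E.
rewrite [X in _ + X](eq_bigr (fun i => `|y 0 i| / B')) => [|i _].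
  by rewrite -mulr_suml subrK.
by rewrite liftK.
Qed.

Lemma simq_plus_law_eq0 y s (j : 'I_k) (i : 'I_d) :
  s j = lift ord0 i -> y 0 i = 0 -> seed_law (q := Q) y s = 0.
Proof.
move=> sj yi; rewrite /= /simq_plus_law (bigD1 j)//= /simq_law sj liftK yi.
by rewrite normr0 !mul0r.
Qed.

(** Shifted by [lift ord0], the occurring indices are distinct values of s, and a sequence of length
    k takes at most k values. Hence k sign bits are enough. *)
Lemma size_occurring s : (size (occurring (type_of (p := p) (B := B) s)) <= k)%N.
Proof.
rewrite -[leqRHS]card_ord -(size_codom s) -(size_map (lift ord0)).
apply: uniq_leq_size.
  rewrite map_inj_uniq; last exact: lift_inj.
  by rewrite filter_uniq// enum_uniq.
move=> _ /mapP[i + ->]; rewrite mem_filter ffunE card_gt0 => /andP[/set0Pn[j]].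
by rewrite inE => /eqP <- _; exact: codom_f.
Qed.

(** An index that was never sampled gives 0 on both sides. A sampled one has its bit at a position
    below k, and the sign of a nonzero y_i is -1 to the power of that bit. *)
Lemma simq_plus_decode_encode y s :
  (forall j i, s j = lift ord0 i -> y 0 i != 0) ->
  Defs.decode (encode (q := Q) y s) = output (q := Q) y s.
Proof.
move=> sy; apply/rowP => i; rewrite simq_plus_outputE /simq_plus_weight /= /simq_plus_decode mxE.
set t := type_of _; have tE : t (lift ord0 i) = occurrences s (lift ord0 i).
  by rewrite ffunE.
have [t0|t0] := posnP (t (lift ord0 i)).
  by rewrite -tE t0 mul0r !mulr0 !mul0r.
have yi0 : y 0 i != 0.
  move: t0; rewrite tE card_gt0 => /set0Pn[j]; rewrite inE => /eqP; exact: sy.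
have it : i \in occurring t by rewrite mem_filter t0 mem_enum.
have ik : (index i (occurring t) < k)%N.
  by rewrite (leq_trans _ (size_occurring s))// index_mem.
rewrite -tE mulrA [B' / _ * _]mulrAC; congr (_ * _).
rewrite (nth_map (Ordinal ik)) ?size_enum_ord// nth_enum_ord//.
by rewrite (nth_map i) ?index_mem// nth_index// sgr_def yi0.
Qed.

(** Stars and bars: a type writes k as an ordered sum of d + 1 natural numbers. The sign vector
    contributes the factor 2^k. *)
Lemma card_simq_plus_messages :
  ([set encode (q := Q) y s | y in [set: 'rV[R]_d] & s in [set: seed Q]]
     #<= `I_('C(d + k, k) * 2 ^ k))%card.
Proof.
(* No count exceeds k, so a type fits in a tuple over ['I_k.+1], which places the types in a finite
   set. *)
pose types := [set t : d.+1.-tuple 'I_k.+1 | (\sum_(i <- t) i)%N == k]%SET.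
pose A := finset.setX types [set: k.-tuple bool]%SET.
have -> : ('C(d + k, k) * 2 ^ k)%N = #|A|.
  rewrite cardsX cardsT card_tuple card_bool card_ord_partitions.
  by rewrite -(bin_sub (leq_addl d k)) addnK.
apply: card_le_trans (card_finset_le A).
(* [g] reads an element of [A] as a message; its image of [A] covers all encoder outputs. *)
pose g (u : d.+1.-tuple 'I_k.+1 * k.-tuple bool) :=
  ([ffun i => tnth u.1 i : nat], u.2).
apply: card_le_trans (card_image_le g _); apply: subset_card_le.
move=> _ [y _] [s _] <-.
have occk i : (occurrences s i < k.+1)%N.
  by rewrite ltnS -[leqRHS]card_ord max_card.
exists ([tuple inord (occurrences s i) | i < d.+1], sign_bits k y (type_of s)).
  rewrite /A /= inE finset.inE /= finset.inE andbT big_map big_enum /=.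
  under eq_bigr do rewrite inordK//.
  apply/eqP; transitivity (\sum_(j < k) 1)%N; last by rewrite sum1_card card_ord.
  (* Group the k draws by their value: the counts add up to k. *)
  rewrite (partition_big s xpredT)//=; apply: eq_bigr => i _.
  rewrite /occurrences -sum1_card; apply: eq_bigl => j.
  by rewrite finset.inE.
by congr pair; apply/ffunP => i; rewrite !ffunE /= tnth_mktuple inordK.
Qed.

(** Since 2^(k log2 x) = x^k, the first two terms of the exponent produce (e (d/k + 1))^k and the
    last one 2^k. *)
Lemma simq_plus_bits : (0 < k)%N ->
  ('C(d + k, k) * 2 ^ k)%:R <=
  2 `^ (k%:R * log2 (expR 1) + k%:R * log2 (d%:R / k%:R + 1) + k%:R) :> R.
Proof.
move=> k0; have D (a b : R) : 2 `^ (a + b) = 2 `^ a * 2 `^ b.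
  by rewrite powRD// pnatr_eq0 implybT.
have L (x : R) : 0 < x -> 2 `^ (k%:R * log2 x) = x ^+ k.
  by move=> x0; rewrite mulrC powRrM powR_log2// powR_mulrn// ltW.
have dk : 0 < d%:R / k%:R + 1 :> R by rewrite ltr_wpDl// divr_ge0.
rewrite !D !L ?expR_gt0// powR_mulrn// natrM natrX ler_wpM2r ?exprn_ge0//.
by rewrite -exprMn bin_le_expR.
Qed.

Hypotheses (B0 : 0 < B) (d0 : (0 < d)%N) (k0 : (0 < k)%N).

Let B'0 : B' != 0.
Proof. by rewrite mulf_neq0 ?gt_eqF// powR_gt0// ltr0n. Qed.

Let k0' : k%:R != 0 :> R.
Proof. by rewrite pnatr_eq0 -lt0n. Qed.

Lemma simq_plus_mean y (i : 'I_d) :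
  \sum_s simq_plus_weight i s * seed_law y s = `|y 0 i|.
Proof.
rewrite /simq_plus_weight.
under eq_bigr do rewrite mulrAC -mulrA.
rewrite -mulr_sumr (sum_prod_occurrences _ (sum_simq_law y)) card_ord.
by rewrite /simq_law liftK mulrA divfK// mulrCA divff// mulr1.
Qed.

Lemma simq_plus_second_moment y (i : 'I_d) :
  \sum_s simq_plus_weight i s ^+ 2 * seed_law y s
  = B' / k%:R * `|y 0 i| * (1 - `|y 0 i| / B') + y 0 i ^+ 2.
Proof.
rewrite /simq_plus_weight; under eq_bigr do rewrite exprMn mulrAC -mulrA.
rewrite -mulr_sumr (sum_prod_occurrences_sqr _ (sum_simq_law y)) card_ord.
rewrite /simq_law liftK -[y 0 i ^+ 2]real_normK ?num_real//.
move: B'0; set c := B * _ => c0; field.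
by rewrite c0 k0'.
Qed.

End SimQplus.

(** * Conditional expectations given Y, for a run of any quantizer *)

Section Run.
Variables (disp : measure_display) (T : measurableType disp) (R : realType).
Variables (P : probability T R) (d : nat) (Y : T -> 'rV[R]_d).

Lemma sigma_rV_setI (A C : set T) :
  sigma_rV Y A -> sigma_rV Y C -> sigma_rV Y (A `&` C).
Proof.
move=> [A' mA' <-] [C' mC' <-]; exists (A' `&` C'); first exact: measurableI.
by rewrite !setTI preimage_setI.
Qed.

Lemma sigma_rV_coord (i : 'I_d) (C : set R) :
  measurable C -> sigma_rV Y ((fun w => Y w 0 i) @^-1` C).
Proof.
move=> mC; exists ((fun t : d.-tuple R => tnth t i) @^-1` C).
  by rewrite -[X in measurable X]setTI; exact: (measurable_tnth i).
by rewrite setTI; apply/seteqP; split=> w /=; rewrite tnth_mktuple.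
Qed.

Lemma sigma_rV_gt0 (i : 'I_d) : sigma_rV Y [set w | 0 < Y w 0 i].
Proof.
have -> : [set w | 0 < Y w 0 i] = (fun w => Y w 0 i) @^-1` `]0, +oo[.
  by apply/seteqP; split=> w /=; rewrite in_itv /= andbT.
exact: sigma_rV_coord.
Qed.

Lemma sigma_rV_lt0 (i : 'I_d) : sigma_rV Y [set w | Y w 0 i < 0].
Proof.
have -> : [set w | Y w 0 i < 0] = (fun w => Y w 0 i) @^-1` `]-oo, 0[.
  by apply/seteqP; split=> w /=; rewrite in_itv.
exact: sigma_rV_coord.
Qed.

Hypothesis mY : random_vector Y.

Lemma measurable_sigma_rV (A : set T) : sigma_rV Y A -> measurable A.
Proof. by move=> [A' mA' <-]; exact: mY. Qed.

(** Multiplying by the sign of Y_i is a difference of two restrictions, to events of [sigma_rV Y].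
    Integral identities known only over such events thus carry over to products with the sign, which
    replaces a general rule for pulling out known factors. *)
Lemma integral_mul_sg (i : 'I_d) (f : T -> R) :
  P.-integrable setT (EFin \o f) ->
  P.-integrable setT (EFin \o (fun w => f w * Num.sg (Y w 0 i))) /\
  forall A : set T, sigma_rV Y A ->
  (\int[P]_(w in A) (f w * Num.sg (Y w 0 i))%R%:E =
   \int[P]_(w in A `&` [set w | (0 < Y w 0 i)%R]) (f w)%:E -
   \int[P]_(w in A `&` [set w | (Y w 0 i < 0)%R]) (f w)%:E)%E.
Proof.
move=> intf; set Ep := [set w | 0 < Y w 0 i]; set En := [set w | Y w 0 i < 0].
have mEp := measurable_sigma_rV (sigma_rV_gt0 i); have mEn := measurable_sigma_rV (sigma_rV_lt0 i).
have memp w : (w \in Ep) = (0 < Y w 0 i) by apply/idP/idP; rewrite inE.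
have memn w : (w \in En) = (Y w 0 i < 0) by apply/idP/idP; rewrite inE.
have split_sg : EFin \o (fun w => f w * Num.sg (Y w 0 i)) =
    (((EFin \o f) \_ Ep) \- ((EFin \o f) \_ En))%E.
  apply/funext => w; rewrite /= !patchE.
  rewrite memp memn.
  case: sgrP => _; rewrite ?mulr0 ?mulr1 ?mulrN1 ?sube0 ?sub0e ?subee//.
have int_restrict (D E : set T) : measurable D -> measurable E ->
    P.-integrable D ((EFin \o f) \_ E).
  move=> mD mE; apply/integrable_restrict => //.
  by apply: integrableS intf => //; exact: measurableI.
rewrite split_sg; split; first by apply: integrableB => //; exact: int_restrict.
move=> A sA; have mA := measurable_sigma_rV sA.
transitivity (\int[P]_(w in A) ((EFin \o f) \_ Ep \- (EFin \o f) \_ En) w)%E.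
  by rewrite -split_sg.
rewrite integralB//; [|exact: int_restrict..].
by rewrite !integral_mkcondr.
Qed.

Variables (Q : quantizer R d) (S : T -> seed Q).
Hypothesis runS : is_run P Y S.

(** There are finitely many seeds, so c(S) is a finite combination of the indicators of {S = s}, and
    the definition of a run applies term by term. *)
Lemma run_integrable_integral (c : seed Q -> R) :
  [/\ P.-integrable setT (EFin \o (c \o S)),
      P.-integrable setT (EFin \o (fun w => \sum_s c s * seed_law (Y w) s)) &
      forall A : set T, sigma_rV Y A ->
        (\int[P]_(w in A) (c (S w))%:E =
         \int[P]_(w in A) (\sum_s c s * seed_law (Y w) s)%R%:E)%E].
Proof.
have cSE : EFin \o (c \o S) =
    (fun w => \sum_s (c s)%:E * (\1_(S @^-1` [set s]) w)%:E)%E.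
  apply/funext => w /=; rewrite (bigD1 (S w))//= big1 ?adde0.
    by rewrite indicE mem_set// mule1.
  by move=> s sS; rewrite indicE memNset ?mule0//= => Ss; rewrite Ss eqxx in sS.
have lawE : EFin \o (fun w => \sum_s c s * seed_law (Y w) s) =
    (fun w => \sum_s (c s)%:E * (seed_law (Y w) s)%:E)%E.
  by apply/funext => w; rewrite /= -sumEFin.
have intS s : P.-integrable setT
    (fun w => ((c s)%:E * (\1_(S @^-1` [set s]) w)%:E)%E).
  by apply: integrableZl => //; have [_ []] := runS s.
have intL s : P.-integrable setT
    (fun w => ((c s)%:E * (seed_law (Y w) s)%:E)%E).
  by apply: integrableZl => //; have [_ []] := runS s.
split; first by rewrite cSE; apply: integrable_sum.
  by rewrite lawE; apply: integrable_sum.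
move=> A sA; have mA := measurable_sigma_rV sA.
transitivity (\int[P]_(w in A) (EFin \o (c \o S)) w)%E => //.
transitivity (\int[P]_(w in A)
    (EFin \o (fun w => \sum_s c s * seed_law (Y w) s)%R) w)%E => //.
rewrite cSE lawE !integral_sum//; last first.
  by move=> s; apply: integrableS (intS s).
  by move=> s; apply: integrableS (intL s).
apply: eq_bigr => s _; have [_ [i1 i2 _ eqA]] := runS s.
rewrite !integralZl//; [|exact: integrableS i2|exact: integrableS i1].
by rewrite eqA.
Qed.

(** For each s, the event D where the law of s vanishes lies in [sigma_rV Y], so P(S = s and D) is
    the integral over D of that law, namely 0. Finitely many null events are then discarded
    together. *)
Lemma run_support : {ae P, forall w, seed_law (Y w) (S w) != 0}.
Proof.
have : \forall w \ae P, forall s, S w = s -> seed_law (Y w) s != 0.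
  apply: filter_forall => s; have [mS [_ _ sL eqA]] := runS s.
  pose D := (fun w => seed_law (Y w) s) @^-1` [set 0].
  have sD : sigma_rV Y D by exact: sL.
  have mD := measurable_sigma_rV sD.
  have PD : P (S @^-1` [set s] `&` D) = 0%E.
    by rewrite -integral_indic// eqA//; apply: integral0_eq => w ->.
  exists (S @^-1` [set s] `&` D); split => //; first exact: measurableI.
  by move=> w /= /not_implyP[Sw /negP]; rewrite negbK => /eqP.
by apply: filterS => w; exact.
Qed.

End Run.

(** * SimQ+ on a random input: representation, unbiasedness, second moment *)

Section RunSimQplus.
Variables (disp : measure_display) (T : measurableType disp) (R : realType).
Variables (P : probability T R) (d k : nat) (p B : R).
Variables (Y : T -> 'rV[R]_d) (S : T -> seed (SimQplus d k p B)).
Hypotheses (B0 : 0 < B) (d0 : (0 < d)%N) (k0 : (0 < k)%N).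
Hypotheses (mY : random_vector Y) (runS : is_run P Y S).

Local Notation B' := (B * d%:R `^ p^-1).
Local Notation weight := (@simq_plus_weight R d k p B).

Lemma simq_plus_representable :
  representable_in_bits P Y S
    (k%:R * log2 (expR 1) + k%:R * log2 (d%:R / k%:R + 1) + k%:R).
Proof.
split.
  exists ('C(d + k, k) * 2 ^ k)%N; split; last exact: simq_plus_bits.
  exact: card_simq_plus_messages.
(* A sampled coordinate equal to 0 would give the drawn seed probability 0, which almost surely does
   not happen. *)
apply: filterS (run_support mY runS) => w law0.
apply: simq_plus_decode_encode => j i sj; apply: contra law0 => /eqP yi.
by apply/eqP; exact: simq_plus_law_eq0 sj yi.
Qed.

Lemma quantizedE w (i : 'I_d) :
  quantized Y S w 0 i = weight i (S w) * Num.sg (Y w 0 i).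
Proof. exact: simq_plus_outputE. Qed.

Lemma quantized_integrable (i : 'I_d) :
  P.-integrable setT (EFin \o (fun w => quantized Y S w 0 i)).
Proof.
have [intS _ _] := run_integrable_integral mY runS (weight i).
have -> : (fun w => quantized Y S w 0 i) =
    (fun w => weight i (S w) * Num.sg (Y w 0 i)).
  by apply/funext => w; exact: quantizedE.
by have [] := integral_mul_sg mY i intS.
Qed.

(** The weight has conditional mean |Y_i|, and Y_i = |Y_i| sg(Y_i). Cutting an event of [sigma_rV Y]
    by the sign of Y_i stays in [sigma_rV Y], so the two integrals agree on each piece. *)
Lemma simq_plus_unbiased (i : 'I_d) :
  is_cond_expectation P Y (fun w => quantized Y S w 0 i) (fun w => Y w 0 i).
Proof.
have [intS intL eqSL] := run_integrable_integral mY runS (weight i).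
have lawE : (fun w => \sum_s weight i s * seed_law (Y w) s) =
    (fun w => `|Y w 0 i|).
  by apply/funext => w; exact: simq_plus_mean.
have YE : (fun w => Y w 0 i) = (fun w => `|Y w 0 i| * Num.sg (Y w 0 i)).
  by apply/funext => w; rewrite mulrC -numEsg.
rewrite lawE in intL.
have [_ splitS] := integral_mul_sg mY i intS.
have [intY splitY] := integral_mul_sg mY i intL.
split.
- exact: quantized_integrable.
- by rewrite YE.
- by move=> C mC; exact: sigma_rV_coord.
move=> A sA.
transitivity (\int[P]_(w in A) (weight i (S w) * Num.sg (Y w 0 i))%R%:E)%E.
  by apply: eq_integral => w _; rewrite quantizedE.
transitivity (\int[P]_(w in A) (`|Y w 0 i| * Num.sg (Y w 0 i))%R%:E)%E;
  last by apply: eq_integral => w _; rewrite mulrC -numEsg.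
rewrite splitS// splitY// !eqSL.
- by congr (_ - _)%E; apply: eq_integral => w _; rewrite [X in X%:E](congr1 (@^~ w) lawE).
- by apply: sigma_rV_setI => //; exact: sigma_rV_lt0.
- by apply: sigma_rV_setI => //; exact: sigma_rV_gt0.
Qed.

Lemma simq_plus_second_moment_le (q : R) :
  0 < p -> 0 < q -> q <= 2 -> p^-1 + q^-1 = 1 ->
  {ae P, forall w, lqnorm q (Y w) <= B} ->
  ('E_P[fun w => (lqnorm 2 (quantized Y S w) ^+ 2)%R]
     <= (B ^+ 2 * d%:R `^ (2 / p) / k%:R + B ^+ 2)%:E)%E.
Proof.
move=> p0 q0 q2 pq YB; have k0' : 0 < k%:R :> R by rewrite ltr0n.
have B'0 : 0 < B' by rewrite mulr_gt0// powR_gt0// ltr0n.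
rewrite unlock.
(* [W] dominates the squared norm of the output, as a squared sign is at most 1, and depends on the
   seed alone; [U] is its conditional mean. *)
pose W s := \sum_i weight i s ^+ 2.
pose U w :=
  \sum_i (B' / k%:R * `|Y w 0 i| * (1 - `|Y w 0 i| / B') + Y w 0 i ^+ 2).
have [intW intU eqWU] := run_integrable_integral mY runS W.
have UE : (fun w => \sum_s W s * seed_law (Y w) s) = U.
  apply/funext => w; rewrite /W /U; under eq_bigr do rewrite mulr_suml.
  rewrite exchange_big; apply: eq_bigr => i _; exact: simq_plus_second_moment.
have WU : (\int[P]_w (W (S w))%:E = \int[P]_w (U w)%:E)%E.
  (* The whole space belongs to [sigma_rV Y], so the full expectations agree. *)
  rewrite eqWU; last by exists setT; rewrite // setTI preimage_setT.
  by apply: eq_integral => w _; rewrite [X in X%:E](congr1 (@^~ w) UE).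
rewrite UE in intU.
have U0 w : 0 <= U w.
  apply: sumr_ge0 => i _.
  (* The bound on Y holds only almost surely, while nonnegativity is asked everywhere and 1 -
     |Y_i|/B' may be negative. Regrouping the quadratic terms shows the sign, since 1/k <= 1. *)
  have -> : B' / k%:R * `|Y w 0 i| * (1 - `|Y w 0 i| / B') + Y w 0 i ^+ 2
      = B' / k%:R * `|Y w 0 i| + (1 - k%:R^-1) * Y w 0 i ^+ 2.
    rewrite -[Y w 0 i ^+ 2]real_normK ?num_real//.
    by move: B'0; set c := B * _ => c0; field; rewrite !gt_eqF.
  apply: addr_ge0; first by rewrite mulr_ge0// divr_ge0 ?ltW.
  by rewrite mulr_ge0 ?sqr_ge0// subr_ge0 invf_le1// ler1n.
have UB w : lqnorm q (Y w) <= B ->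
    U w <= B ^+ 2 * d%:R `^ (2 / p) / k%:R + B ^+ 2.
  move=> yB; rewrite /U big_split/= lerD//; last exact: sum_sqr_le_lqnorm yB.
  (* Bound the factor 1 - |Y_i|/B' by 1, then use ||Y||_1 <= B'. *)
  apply: (@le_trans _ _ (B' / k%:R * lqnorm 1 (Y w))).
    rewrite lqnorm1E mulr_sumr; apply: ler_sum => i _.
    apply: ler_piMr; first by rewrite mulr_ge0// divr_ge0// ltW.
    by rewrite gerBl divr_ge0// ltW.
  have -> : B ^+ 2 * d%:R `^ (2 / p) / k%:R = B' / k%:R * B'.
    by rewrite [2 / p]mulrC powRrM powR_mulrn ?powR_ge0//; field; rewrite gt_eqF.
  by rewrite ler_wpM2l ?divr_ge0 ?(ltW B'0)//; exact: lqnorm1_le_lqnorm yB.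
apply: (@le_trans _ _ (\int[P]_w (W (S w))%:E)%E).
  apply: ge0_le_integral => //.
  - by move=> w _; rewrite lee_fin sqr_ge0.
  - apply/measurable_EFinP; under eq_fun do rewrite lqnorm2_sqr.
    apply: measurable_sum => i; apply: measurable_funX.
    by apply/measurable_EFinP; exact: measurable_int (quantized_integrable i).
  - exact: measurable_int intW.
  - move=> w _; rewrite lee_fin lqnorm2_sqr; apply: ler_sum => i _.
    rewrite quantizedE exprMn ler_piMr ?sqr_ge0//.
    by rewrite sqr_sg (ler_nat _ _ 1) leq_b1.
rewrite WU.
apply: (@le_trans _ _
  (\int[P]_w (B ^+ 2 * d%:R `^ (2 / p) / k%:R + B ^+ 2)%:E)%E).
  apply: ae_ge0_le_integral => //.
  - by move=> w _; rewrite lee_fin U0.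
  - exact: measurable_int intU.
  - by move=> w _; rewrite lee_fin addr_ge0 ?divr_ge0 ?mulr_ge0 ?powR_ge0 ?(ltW B0).
  - by apply: filterS YB => w yB _; rewrite lee_fin UB.
by rewrite integral_cst// [X in (_ * X)%E](probability_setT P) mule1.
Qed.

End RunSimQplus.

Theorem theorem4p2 (R : realType) (d k : nat) (p q B : R)
    (hd : (1 <= d)%N) (hp : 2 <= p) (hq : q = p / (p - 1)) (hB : 0 < B)
    (hk : (1 <= k)%N) :
  let Q := SimQplus d k p B in
  (forall (disp : measure_display) (T : measurableType disp)
          (P : probability T R) (Y : T -> 'rV[R]_d) (S : T -> seed Q),
     random_vector Y ->
     {ae P, forall w, lqnorm q (Y w) <= B} ->
     is_run P Y S ->
     representable_in_bits P Y S
       (k%:R * log2 (expR 1) + k%:R * log2 (d%:R / k%:R + 1) + k%:R) /\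
     (forall i : 'I_d,
        is_cond_expectation P Y (fun w => quantized Y S w 0 i)
                                (fun w => Y w 0 i))) /\
  (alpha0 B Q p%:E <=
     (Num.sqrt (B ^+ 2 * d%:R `^ (2 / p) / k%:R + B ^+ 2))%:E)%E.
Proof.
move=> Q; split=> [disp T P Y S mY _ runS|].
  by split=> [|i]; [exact: simq_plus_representable | exact: simq_plus_unbiased].
have p0 : 0 < p by rewrite (lt_le_trans _ hp).
have p1 : 0 < p - 1 by rewrite subr_gt0 (lt_le_trans _ hp)// ltr1n.
have q0 : 0 < q by rewrite hq divr_gt0.
(* p <= 2(p - 1) is the same as 2 <= p. *)
have q2 : q <= 2 
  by rewrite hq ler_pdivrMr// mulrBr mulr1 mulr_natl mulr2n lerBrDr lerD2l.
have pq : p^-1 + q^-1 = 1.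
  by rewrite hq; field; rewrite !gt_eqF.
have qE : fine (hoelder_conjugate p%:E) = q.
  by rewrite /hoelder_conjugate /= eqe gt_eqF// inver gt_eqF// hq.
apply: ge_ereal_sup => _ [disp [T [P [Y [S [mY + runS ->]]]]]]; rewrite qE => YB.
(* Both sides are extended square roots, so it suffices to compare the second moments. *)
rewrite -[leRHS]/(sqrte _%:E) lee_sqrt; last first.
  by rewrite lee_fin addr_ge0 ?divr_ge0 ?mulr_ge0 ?powR_ge0 ?(ltW hB).
apply: (simq_plus_second_moment_le _ _ _ _ _ p0 q0) => //.
by apply: filterS YB => w; rewrite ler_pXn2r ?nnegrE ?powR_ge0// (ltW hB).
Qed.
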